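(* Let $(x_n),(y_n)$ be the sequences generated by the stochastic Halpern-Mann iteration $$y_n:=(1-\alpha_n)(Tx_n+\xi_n)+\alpha_nu,\qquad x_{n+1}:=(1-\beta_n)(Uy_n+\delta_n)+\beta_ny_n .$$ Assume that $K_0\in\mathbb{N}^*$ is such that for all $n\in\mathbb{N}$ $$\mathbb{E}[\|Tx_n-u\|],\ \mathbb{E}[\|Uy_n-y_n\|],\ \mathbb{E}[\|Uu-u\|],\ \mathbb{E}[\|Uy_n-u\|]\le K_0 .$$ Suppose that $\sum_{n=0}^\infty\alpha_n=\infty$ with rate of divergence $\theta$, that $$\sum_{n=0}^\infty \mathbb{E}[\|\xi_{n+1}-\xi_n\|],\quad \sum_{n=0}^\infty\mathbb{E}[\|\delta_{n+1}-\delta_n\|],\quad \sum_{n=0}^\infty|\alpha_{n+1}-\alpha_n|,\quad \sum_{n=0}^\infty|\beta_{n+1}-\beta_n|$$ are all finite, with rates of convergence $\chi_1,\chi_2,\chi_3,\chi_4$ and upper bounds $B_1,B_2,B_3,B_4$, respectively, and that $\mathbb{E}[\|\xi_n\|]\le E_0$ and $\mathbb{E}[\|\delta_n\|]\le D_0$ for all $n\in\mathbb{N}$. Define $$\chi(\varepsilon):=\max\left\{\chi_1\left(\tfrac{\varepsilon}{4}\right),\chi_2\left(\tfrac{\varepsilon}{4}\right),\chi_3\left(\tfrac{\varepsilon}{4(E_0+K_0)}\right),\chi_4\left(\tfrac{\varepsilon}{4(D_0+K_0)}\right)\right\},$$ $$B:=B_1+B_2+B_3(E_0+K_0)+B_4(D_0+K_0),\qquad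 K:=2K_0+E_0+D_0+B,$$ $$\varphi_{K,\theta,\chi}(\varepsilon):=\theta\left(\chi\left(\tfrac{\varepsilon}{2}\right),\ln\left(\tfrac{2K}{\varepsilon}\right)\right)+1,\qquad \psi_{K,\theta,\chi}(\lambda,\varepsilon):=\varphi_{K,\theta,\chi}\left(\tfrac{\lambda\varepsilon}{2}\right).$$ Then $\mathbb{E}[\|x_{n+1}-x_n\|]\to0$ with rate $\varphi_{K,\theta,\chi}$, and $\|x_{n+1}-x_n\|\to0$ almost surely with rate $\psi_{K,\theta,\chi}$.
   Context: $\mathbb{N}=\{0,1,2,\dots\}$, $\mathbb{N}^*=\mathbb{N}\setminus\{0\}$. $(\Omega,\mathcal{F},\mathbb{P})$ is a probability space, $(X,\|\cdot\|)$ is a separable real normed space, and an $X$-valued random variable is a measurable function $\Omega\to X$. $T,U:X\to X$ are nonexpansive ($\|Tx-Ty\|\le\|x-y\|$, $\|Ux-Uy\|\le\|x-y\|$ for all $x,y\in X$); $x_0$ (the starting point) and $u$ (the anchor) are arbitrary $X$-valued random variables; $(\xi_n),(\delta_n)$ are sequences of $X$-valued random variables; $(\alpha_n),(\beta_n)\subseteq[0,1]$ are deterministic. Rates. For nonnegative reals $(a_n)$: a rate (of convergence) for $a_n\to0$ is a function $\varphi:(0,\infty)\to\mathbb{N}$ with $a_n<\varepsilon$ for all $\varepsilon>0$ and $n\ge\varphi(\varepsilon)$. A rate of convergence for $\sum_{n=0}^\infty a_n<\infty$ is a function $\chi:(0,\infty)\to\mathbb{N}$ with $\sum_{n=\chi(\varepsilon)}^\infty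 a_n<\varepsilon$ for all $\varepsilon>0$. A rate of divergence for $\sum_{n=0}^\infty a_n=\infty$ is a function $\theta:\mathbb{N}\times(0,\infty)\to\mathbb{N}$ with $\sum_{n=k}^{\theta(k,b)}a_n\ge b$ for all $b>0$, $k\in\mathbb{N}$ (so $\theta(k,b)\ge k$); by convention $\theta(k,b):=k$ for $b\le0$. For nonnegative random variables $(X_n)$: a rate for $X_n\to0$ almost surely is a function $\Phi:(0,\infty)^2\to\mathbb{N}$ with $\mathbb{P}(\exists n\ge\Phi(\lambda,\varepsilon)\,(X_n\ge\varepsilon))<\lambda$ for all $\lambda,\varepsilon>0$. *)

(* Defs.v *)
From mathcomp Require Import all_boot all_order all_algebra.
From mathcomp Require Import all_classical all_reals all_analysis.
Set Implicit Arguments.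
Unset Strict Implicit.
Unset Printing Implicit Defensive.
Import Order.TTheory GRing.Theory Num.Theory.
Import numFieldNormedType.Exports.
Local Open Scope classical_set_scope.
Local Open Scope ring_scope.

(* Functions on (0, +oo) are represented by functions on R of which only the
   values at positive arguments matter; divergence rates are defined on all of
   R by the convention stated there. *)

Definition separable (X : topologicalType) : Prop :=
  exists2 D : set X, countable D & dense D.

Definition borel_random_variable d (Omega : measurableType d) (R : realType)
    (X : normedModType R) (f : Omega -> X) : Prop :=
  measurable_fun [set: Omega] (f : Omega -> g_sigma_algebraType (@open X)).

Definition nonexpansive (R : realType) (X : normedModType R) (T : X -> X) :
    Prop :=
  forall x y : X, `|T x - T y| <= `|x - y|.

Section Rates.
Variable R : realType.

(* The sequences of expectations below may a priori take the value +oo. *)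
Definition rate_to0 (a : nat -> \bar R) (phi : R -> nat) : Prop :=
  forall eps : R, 0 < eps ->
  forall n : nat, (phi eps <= n)%N -> (a n < eps%:E)%E.

Definition rate_sum_convergence (a : nat -> \bar R) (chi : R -> nat) : Prop :=
  (\sum_(0 <= n <oo) a n < +oo)%E /\
  forall eps : R, 0 < eps -> (\sum_(chi eps <= n <oo) a n < eps%:E)%E.

(* The second clause is the convention theta(k, b) := k for b <= 0. *)
Definition rate_sum_divergence (a : nat -> R) (theta : nat -> R -> nat) :
    Prop :=
  (forall (k : nat) (b : R), 0 < b -> b <= \sum_(k <= n < (theta k b).+1) a n)
  /\ (forall (k : nat) (b : R), b <= 0 -> theta k b = k).

Definition rate_as_to0 d (Omega : measurableType d) (P : probability Omega R)
    (Y : nat -> Omega -> R) (Phi : R -> R -> nat) : Prop :=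
  forall lambda eps : R, 0 < lambda -> 0 < eps ->
  (P [set w | exists2 n : nat, (Phi lambda eps <= n)%N & (eps <= Y n w)%R]
     < lambda%:E)%E.

Definition phi_rate (K : R) (theta : nat -> R -> nat) (chi : R -> nat)
    (eps : R) : nat :=
  (theta (chi (eps / 2)) (ln (2 * K / eps))).+1.

Definition psi_rate (K : R) (theta : nat -> R -> nat) (chi : R -> nat)
    (lambda eps : R) : nat :=
  phi_rate K theta chi (lambda * eps / 2).

Definition chi_max (chi1 chi2 chi3 chi4 : R -> nat) (K0 E0 D0 : R) (eps : R) :
    nat :=
  maxn (maxn (chi1 (eps / 4)) (chi2 (eps / 4)))
       (maxn (chi3 (eps / (4 * (E0 + K0)))) (chi4 (eps / (4 * (D0 + K0))))).

End Rates.

Definition halpern_mann d (Omega : measurableType d) (R : realType)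
    (X : normedModType R) (T U : X -> X) (x0 u : Omega -> X)
    (xi delta : nat -> Omega -> X) (alpha beta : nat -> R)
    (x y : nat -> Omega -> X) : Prop :=
  [/\ forall w, x 0%N w = x0 w,
      forall n w,
        y n w = (1 - alpha n) *: (T (x n w) + xi n w) + alpha n *: u w
    & forall n w,
        x n.+1 w = (1 - beta n) *: (U (y n w) + delta n w) + beta n *: y n w].

(* Main.v *)
Require Import Defs.
From mathcomp Require Import all_boot all_order all_algebra.
From mathcomp Require Import all_classical all_reals all_analysis.
From mathcomp Require Import measurable_realfun ring lra.
Import Order.TTheory GRing.Theory Num.Theory.
Import numFieldNormedType.Exports.
Local Open Scope classical_set_scope.
Local Open Scope ring_scope.

(** Write [A_n = |x_(n+1) - x_n|]. Subtracting two consecutive steps of the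
    iteration and using that [U] is nonexpansive gives, pathwise,

      [A_(n+1) <= (1 - alpha_n) |T x_(n+1) - T x_n| + C_n]

    where [C_n >= 0] collects the increments of [xi], [delta], [alpha] and
    [beta] ([halpern_mann_increment]). The hypotheses
    make the expectations of the [C_n] summable with rate [chi]
    ([chi_max_tail]). The coefficient is [alpha_n] rather than [alpha_(n+1)],
    at the price of evaluating [T x - u] in [C_n] at the later iterate; this
    makes the products below start at the same index as the sums in the
    definition of a rate of divergence.

    Convergence in mean. Since [T] is nonexpansive, [|T x_(n+1) - T x_n|] is
    at most [A_n], so from [k = chi (eps / 2)] on the recursion unrolls to

      [E A_m <= K * prod_(k <= i < m) (1 - alpha_i) + sum_(k <= i < m) E C_i].

    The sum is below [eps / 2]; by [1 - t <= exp (- t)] the product is at most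
    [exp (- ln (2 K / eps)) = eps / (2 K)] as soon as [m] exceeds
    [theta (k, ln (2 K / eps))] ([rate_of_contraction]). The unrolling cannot
    start from [E A_k], which may be infinite when [k = 0] because nothing
    bounds [x_0] itself. It starts from [E |T x_(k+1) - T x_k|], which is at
    most [2 K0 <= K] by the triangle inequality through [u].

    Almost sure convergence. The recursion also gives
    [A_(n+1) <= A_n + C_n], so every [A_m] with [m >= N] is dominated by the
    single random variable [A_N + sum_(i >= N) C_i]. Markov's inequality for
    that variable turns the rate in mean into an almost sure rate
    ([rate_as_of_almost_decreasing]).

    All of this needs the norms involved to be measurable, and for that the
    sum of two Borel random variables must be Borel; this is where
    separability enters ([borel_random_variableD]). *)

Set Implicit Arguments.
Unset Strict Implicit.
Unset Printing Implicit Defensive.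

(** * Borel random variables with values in a normed space *)

Lemma borel_random_variableP d (Omega : measurableType d) (R : realType)
    (X : normedModType R) (f : Omega -> X) :
  borel_random_variable f <->
  (forall O : set X, open O -> measurable (f @^-1` O)).
Proof.
split=> [mf O oO|mf].
  rewrite -[_ @^-1` _]setTI; apply: mf; first exact: measurableT.
  exact: sub_sigma_algebra.
apply: (@measurability _ _ _ (g_sigma_algebraType (@open X)) setT f
  (@open X)) => //.
by move=> _ [V oV <-]; rewrite setTI; exact: mf.
Qed.

Lemma borel_random_variable_comp d (Omega : measurableType d) (R : realType)
    (X Y : normedModType R) (g : X -> Y) (f : Omega -> X) :
  continuous g -> borel_random_variable f ->
  borel_random_variable (fun w => g (f w)).
Proof.
move=> /continuousP cg /borel_random_variableP mf.
by apply/borel_random_variableP => O oO; apply: (mf (g @^-1` O)); exact: cg.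
Qed.

Lemma measurable_normr_borel d (Omega : measurableType d) (R : realType)
    (X : normedModType R) (f : Omega -> X) :
  borel_random_variable f ->
  measurable_fun [set: Omega] (fun w => `|f w| : R).
Proof.
move=> /borel_random_variableP mf.
apply: (measurability _ (RGenOpens.measurableE R)).
move=> _ [_ [a [b ->] <-]]; rewrite setTI.
apply: (mf ((fun x : X => `|x|) @^-1` `]a, b[%classic)).
have /continuousP cn := @norm_continuous R X.
by apply: cn; exact: interval_open.
Qed.

Lemma dense_ball (R : realType) (X : normedModType R) (D : set X) (x : X)
    (r : R) : dense D -> 0 < r -> exists2 p, D p & ball p r x.
Proof.
move=> dD r0; have [|p [bp Dp]] := dD (ball x r) _ (ball_open x r).
  by exists x; exact: ballxx.
by exists p => //; exact: ball_sym.
Qed.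

(** The Borel sets of [X * X] need not be generated by products of Borel sets
    in general. With a countable dense set, however, the preimage of an open
    set under addition is a countable union of products of balls centred in
    the dense set, with radii [1 / (n + 1)]. *)
Lemma borel_random_variableD d (Omega : measurableType d) (R : realType)
    (X : normedModType R) (f g : Omega -> X) : separable X ->
  borel_random_variable f -> borel_random_variable g ->
  borel_random_variable (fun w => f w + g w).
Proof.
move=> [D cD dD] /borel_random_variableP mf /borel_random_variableP mg.
apply/borel_random_variableP => O oO.
pose r (n : nat) : R := n.+1%:R^-1.
have r_gt0 n : 0 < r n by rewrite invr_gt0.
pose cell (t : X * X * nat) : set Omega :=
  f @^-1` ball t.1.1 (r t.2) `&` g @^-1` ball t.1.2 (r t.2).
pose I : set (X * X * nat) := (D `*` D `*` setT) `&`
  [set t | forall a b, ball t.1.1 (r t.2) a -> ball t.1.2 (r t.2) b ->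
                       O (a + b)].
have -> : (fun w => f w + g w) @^-1` O = \bigcup_(t in I) cell t.
  apply/seteqP; split=> [w /= Ow|w [[[p q] n] [_ IO] [fp gq]]]; last exact: IO.
  have [e /= e0 eO] : exists2 e : R, 0 < e & ball (f w + g w) e `<=` O.
    by have /nbhs_ballP := open_nbhs_nbhs (conj oO Ow).
  (* [f w] and [a] lie within [r n] of the centre [p], and [g w] and [b] within
     [r n] of [q], so [f w + g w] and [a + b] differ by less than [4 * r n]. *)
  have [n nlt] : exists n, r n < e / 4.
    have e4 : 0 < e / 4 by lra.
    have [n _ H] := near_infty_natSinv_lt (PosNum e4).
    by exists n; apply: (H n) => /=.
  have [p Dp pf] := dense_ball (f w) dD (r_gt0 n).
  have [q Dq qg] := dense_ball (g w) dD (r_gt0 n).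
  exists (p, q, n); last by split.
  split=> //= a b pa qb; apply: eO.
  move: pf qg pa qb; rewrite -!ball_normE /= => pf qg pa qb.
  have -> : f w + g w - (a + b) = (f w - p) + (p - a) + ((g w - q) + (q - b)).
    by rewrite !subrKA opprD addrACA.
  rewrite (le_lt_trans (ler_normD _ _))//.
  have := ler_normD (f w - p) (p - a); have := ler_normD (g w - q) (q - b).
  by rewrite (distrC (f w)) (distrC (g w)); lra.
rewrite bigcup_set_type; apply: countable_bigcupT_measurable.
  rewrite (eq_countable (card_setT I)).
  apply: (@sub_countable _ _ _ (D `*` D `*` [set: nat])).
    by apply: subset_card_le; exact: subIsetl.
  by apply: countableX => //; exact: countableX.
by move=> t; apply: measurableI; [apply: mf|apply: mg]; exact: ball_open.
Qed.

Lemma borel_random_variableZ d (Omega : measurableType d) (R : realType)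
    (X : normedModType R) (a : R) (f : Omega -> X) :
  borel_random_variable f -> borel_random_variable (fun w => a *: f w).
Proof. by apply: borel_random_variable_comp; exact: scaler_continuous. Qed.

Lemma borel_random_variableB d (Omega : measurableType d) (R : realType)
    (X : normedModType R) (f g : Omega -> X) : separable X ->
  borel_random_variable f -> borel_random_variable g ->
  borel_random_variable (fun w => f w - g w).
Proof.
move=> sX mf mg; apply: borel_random_variableD => //.
by apply: borel_random_variable_comp mg; exact: opp_continuous.
Qed.

Lemma nonexpansive_continuous (R : realType) (X : normedModType R)
    (T : X -> X) : nonexpansive T -> continuous T.
Proof.
move=> neT x; apply/cvgrPdist_lt => e e0; near=> z.
by apply: le_lt_trans (neT _ _) _; near: z; exact: cvgr_dist_lt.
Unshelve. all: by end_near. Qed.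

(** * Expectations of nonnegative random variables *)

(** Expectations may be infinite here, as [E |x_1 - x_0|] can be, hence a form
    of additivity that asks for nonnegativity instead of integrability. *)
Lemma ge0_expectationD d (Omega : measurableType d) (R : realType)
    (P : probability Omega R) (f g : Omega -> R) :
  (forall w, 0 <= f w) -> (forall w, 0 <= g w) ->
  measurable_fun setT f -> measurable_fun setT g ->
  ('E_P[fun w => (f w + g w)%R] = 'E_P[f] + 'E_P[g])%E.
Proof.
move=> f0 g0 mf mg; rewrite unlock.
under eq_integral do rewrite EFinD.
rewrite ge0_integralD//.
- by move=> w _; rewrite lee_fin.
- exact/measurable_EFinP.
- by move=> w _; rewrite lee_fin.
- exact/measurable_EFinP.
Qed.

Lemma ge0_expectationZl d (Omega : measurableType d) (R : realType)
    (P : probability Omega R) (a : R) (f : Omega -> R) :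
  0 <= a -> (forall w, 0 <= f w) -> measurable_fun setT f ->
  ('E_P[fun w => (a * f w)%R] = a%:E * 'E_P[f])%E.
Proof.
move=> a0 f0 mf; rewrite unlock.
under eq_integral do rewrite EFinM.
rewrite ge0_integralZl_EFin//; first by move=> w _; rewrite lee_fin.
exact/measurable_EFinP.
Qed.

Lemma ge0_expectation_le d (Omega : measurableType d) (R : realType)
    (P : probability Omega R) (f g : Omega -> R) :
  (forall w, 0 <= f w) -> measurable_fun setT f -> measurable_fun setT g ->
  (forall w, f w <= g w) -> ('E_P[f] <= 'E_P[g])%E.
Proof.
move=> f0 mf mg fg; apply: expectation_le => //; last exact: aeW.
by move=> w; apply: le_trans (fg w).
Qed.

(** * Rates for almost contracting sequences *)

Lemma prod_le_expR (R : realType) (al : nat -> R) (m n : nat) :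
  (forall i, 0 <= al i <= 1) ->
  \prod_(m <= i < n) (1 - al i) <= expR (- \sum_(m <= i < n) al i).
Proof.
move=> al01; rewrite -sumrN expR_sum.
apply: ler_prod => i _; rewrite subr_ge0 (andP (al01 i)).2 /=.
exact: expR_ge1Dx.
Qed.

Lemma nneseries_tail_le (R : realType) (f : nat -> \bar R) (m n : nat) :
  (forall i, (0 <= f i)%E) -> (m <= n)%N ->
  (\sum_(n <= i <oo) f i <= \sum_(m <= i <oo) f i)%E.
Proof.
move=> f0 mn; rewrite (nneseries_split m (n - m))// subnKC//.
by apply: leeDr; exact: sume_ge0.
Qed.

(** For [b > 0] a sum reaching [b] cannot be empty; for [b <= 0] this is the
    convention on rates of divergence. *)
Lemma rate_sum_divergence_ge (R : realType) (al : nat -> R)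
    (theta : nat -> R -> nat) (k : nat) (b : R) :
  rate_sum_divergence al theta -> (k <= theta k b)%N.
Proof.
move=> [div1 div0]; have [b0|b0] := ltP 0 b; last by rewrite div0.
rewrite leqNgt; apply/negP => thk; have := div1 k b b0.
by rewrite big_geq// leNgt b0.
Qed.

(** Xu's lemma with a rate. The auxiliary sequence [g] carries the uniform
    bound [K] in place of [a], so that [a] may take the value [+oo] at the
    index where the recursion starts: the first step uses [g n <= K], the
    later ones [g n <= a n]. *)
Lemma rate_of_contraction (R : realType) (a g c : nat -> \bar R)
    (al : nat -> R) (K : R) (theta : nat -> R -> nat) (chi : R -> nat) :
  (forall i, 0 <= al i <= 1) -> rate_sum_divergence al theta ->
  0 < K -> (forall n, (0 <= g n)%E) -> (forall n, (0 <= c n)%E) ->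
  (forall n, (g n <= K%:E)%E) -> (forall n, (g n <= a n)%E) ->
  (forall n, (a n.+1 <= (1 - al n)%:E * g n + c n)%E) ->
  (forall eps, 0 < eps -> (\sum_(chi eps <= n <oo) c n < eps%:E)%E) ->
  rate_to0 a (phi_rate K theta chi).
Proof.
move=> al01 div K0 g0 c0 gK ga rec tail eps eps0 n.
rewrite /phi_rate; set k := chi _; set b := ln _ => thn.
have al1 i : 0 <= 1 - al i by rewrite subr_ge0 (andP (al01 i)).2.
have al0 i : 0 <= al i by have /andP[] := al01 i.
pose q m := \prod_(k <= i < m) (1 - al i).
have unrolled j : (a (k + j).+1 <=
    (K * q (k + j).+1)%:E + \sum_(k <= i < (k + j).+1) c i)%E.
  elim: j => [|j IH].
    rewrite addn0 /q !big_nat1 (le_trans (rec k))// leeD2r//.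
    by rewrite mulrC EFinM lee_wpmul2l ?lee_fin.
  rewrite addnS /q !(@big_nat_recr _ _ _ (k + j).+1)/= ?leqW ?leq_addr//.
  rewrite (le_trans (rec _))// addeA leeD2r//.
  apply: (@le_trans _ _ ((1 - al (k + j).+1)%:E *
      ((K * q (k + j).+1)%:E + \sum_(k <= i < (k + j).+1) c i))%E).
    by rewrite lee_wpmul2l ?lee_fin//; exact: le_trans (ga _) IH.
  have s0 : (0 <= \sum_(k <= i < (k + j).+1) c i)%E by exact: sume_ge0.
  rewrite ge0_muleDr//; last first.
    by rewrite lee_fin mulr_ge0 ?(ltW K0)// prodr_ge0.
  rewrite leeD//; first by rewrite -EFinM lee_fin mulrC mulrA.
  by rewrite gee_pMl// lee_fin gerBl.
have eps2 : 0 < eps / 2 by rewrite divr_gt0.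
have kth : (k <= theta k b)%N := rate_sum_divergence_ge k b div.
have bth : b <= \sum_(k <= i < (theta k b).+1) al i.
  have [b0|b0] := ltP 0 b; first exact: div.1.
  by rewrite (le_trans b0)// sumr_ge0.
(* The rate is a successor, so the index is [n.+1] with [theta k b <= n], and
   the product over [k <= i < n.+1] covers the range that [theta] controls. *)
case: n thn => // n thn.
have knE : (k + (n - k))%N = n by rewrite subnKC// (leq_trans kth).
rewrite -knE; apply: le_lt_trans (unrolled _) _; rewrite knE.
have -> : eps%:E = ((eps / 2)%:E + (eps / 2)%:E)%E by rewrite -EFinD -splitr.
apply: lee_ltD => //; last first.
  apply: le_lt_trans (tail _ eps2).
  by apply: nneseries_lim_ge => i _ _; exact: c0.
rewrite lee_fin.
have -> : eps / 2 = K * expR (- b).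
  have bpos : 0 < 2 * K / eps by rewrite divr_gt0// mulr_gt0.
  rewrite expRN lnK// invf_div.
  by field; rewrite !gt_eqF.
rewrite ler_wpM2l ?(ltW K0)//; apply: le_trans (prod_le_expR _ _ al01) _.
rewrite ler_expR lerN2; apply: le_trans bth _.
rewrite [leRHS](@big_cat_nat _ _ _ (theta k b).+1)//=; first last.
  by rewrite leqW.
by rewrite lerDl sumr_ge0.
Qed.

(** An inequality [A (n+1) <= A n + C n] bounds the whole tail of [A] from
    [N] on by the random variable [A N + \sum_(i >= N) C i]. Each of the two
    terms has expectation below [lambda * eps / 2] when
    [N = phi (lambda * eps / 2)], and one application of Markov's inequality
    at level [eps] concludes. *)
Lemma rate_as_of_almost_decreasing d (Omega : measurableType d) (R : realType)
    (P : probability Omega R) (A C : nat -> Omega -> R) (phi : R -> nat) :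
  (forall n w, 0 <= A n w) -> (forall n w, 0 <= C n w) ->
  (forall n, measurable_fun setT (A n)) ->
  (forall n, measurable_fun setT (C n)) ->
  (forall n w, A n.+1 w <= A n w + C n w) ->
  rate_to0 (fun n => 'E_P[A n]%E) phi ->
  (forall eps, 0 < eps -> (\sum_(phi eps <= n <oo) 'E_P[C n] < eps%:E)%E) ->
  rate_as_to0 P A (fun lambda eps => phi (lambda * eps / 2)).
Proof.
move=> A0 C0 mA mC AC rA tail la eps la0 eps0 /=.
have le2 : 0 < la * eps / 2 by rewrite divr_gt0// mulr_gt0.
set N := phi _.
pose S w : \bar R := (\sum_(0 <= i <oo) (C (i + N)%N w)%:E)%E.
have S0 w : (0 <= S w)%E by apply: nneseries_ge0 => i _ _; rewrite lee_fin.
have mEA n : measurable_fun setT (EFin \o A n).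
  exact/measurable_EFinP.
have mEC n : measurable_fun setT (EFin \o C n).
  exact/measurable_EFinP.
have mS : measurable_fun setT S.
  apply: (@ge0_emeasurable_sum _ _ _ setT
    (fun i w => (C (i + N)%N w)%:E) xpredT) => //.
    by move=> k w _ _; rewrite lee_fin.
  by move=> k _; exact: mEC.
pose Z w : \bar R := ((A N w)%:E + S w)%E.
have Z0 w : (0 <= Z w)%E by rewrite adde_ge0 ?lee_fin.
have mZ : measurable_fun setT Z by exact: (emeasurable_funD (mEA N) mS).
have AZ j w : ((A (N + j)%N w)%:E <= Z w)%E.
  have : A (N + j)%N w <= A N w + \sum_(0 <= i < j) C (i + N)%N w.
    elim: j => [|j IH]; first by rewrite addn0 big_geq// addr0.
    rewrite addnS big_nat_recr//= addrA addnC.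
    by rewrite (le_trans (AC _ _))// addnC lerD2r.
  rewrite -lee_fin => /le_trans; apply; rewrite EFinD leeD2l// -sumEFin.
  by apply: nneseries_lim_ge => i _ _; rewrite lee_fin.
have intZ : (\int[P]_w Z w < (la * eps)%:E)%E.
  have -> : (\int[P]_w Z w = 'E_P[A N] + \sum_(N <= i <oo) 'E_P[C i])%E.
    rewrite -nneseries_addn; last by move=> i; exact: expectation_ge0.
    rewrite unlock /Z ge0_integralD//; last 2 first.
    - by move=> w _; rewrite lee_fin.
    - exact: mEA.
    congr (_ + _)%E; rewrite /S integral_nneseries//.
    - by move=> i; exact: mEC.
    - by move=> i w _; rewrite lee_fin.
  have -> : la * eps = la * eps / 2 + la * eps / 2 by rewrite -splitr.
  rewrite EFinD; apply: lteD.
    exact: rA.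
  exact: tail.
have markovZ := @le_integral_comp_abse _ _ _ P _ measurableT Z eps id
  (@measurable_id _ _ setT) (fun r r0 => r0) (fun x y _ _ xy => xy) mZ eps0.
rewrite setTI in markovZ.
have mE : measurable [set w | (eps%:E <= `|Z w|)%E].
  rewrite -[X in measurable X]setTI; apply: emeasurable_fun_c_infty => //.
  exact: measurableT_comp.
have mA' : measurable [set w | exists2 n, (N <= n)%N & eps <= A n w].
  have -> : [set w | exists2 n, (N <= n)%N & eps <= A n w] =
      \bigcup_(n in [set n | (N <= n)%N]) (A n @^-1` `[eps, +oo[%classic).
    apply/seteqP; split=> w [n Nn An]; exists n => //; move: An;
      by rewrite /= in_itv/= andbT.
  apply: bigcup_measurable => n _; rewrite -[X in measurable X]setTI.
  exact: mA.
apply: (@le_lt_trans _ _ (P [set w | (eps%:E <= `|Z w|)%E])).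
  apply: le_measure; rewrite ?inE// => w [n Nn /= epsA].
  by rewrite gee0_abs// (le_trans _ (AZ (n - N)%N w))// subnKC// lee_fin.
rewrite -(@lte_pmul2l _ eps%:E) ?lte_fin// -EFinM [eps * _]mulrC.
apply: le_lt_trans markovZ _; under eq_integral do rewrite gee0_abs//.
exact: intZ.
Qed.

(** Each of the four series is cut so that, after multiplication by its
    coefficient, it contributes less than [eps / 4]. *)
Lemma chi_max_tail (R : realType) (f1 f2 f3 f4 : nat -> \bar R)
    (chi1 chi2 chi3 chi4 : R -> nat) (K0 E0 D0 : R) (eps : R) :
  (forall n, (0 <= f1 n)%E) -> (forall n, (0 <= f2 n)%E) ->
  (forall n, (0 <= f3 n)%E) -> (forall n, (0 <= f4 n)%E) ->
  rate_sum_convergence f1 chi1 -> rate_sum_convergence f2 chi2 ->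
  rate_sum_convergence f3 chi3 -> rate_sum_convergence f4 chi4 ->
  0 < E0 + K0 -> 0 < D0 + K0 -> 0 < eps ->
  (\sum_(chi_max chi1 chi2 chi3 chi4 K0 E0 D0 eps <= n <oo)
     (f1 n + f2 n + (E0 + K0)%:E * f3 n + (D0 + K0)%:E * f4 n) < eps%:E)%E.
Proof.
move=> f10 f20 f30 f40 [_ r1] [_ r2] [_ r3] [_ r4] L0 M0 eps0.
set N := chi_max _ _ _ _ _ _ _ _.
have eps4 : 0 < eps / 4 by rewrite divr_gt0.
have scaled (L : R) (f : nat -> \bar R) (chi : R -> nat) : 0 < L ->
    (forall n, (0 <= f n)%E) -> (chi (eps / (4 * L)) <= N)%N ->
    (forall e, 0 < e -> (\sum_(chi e <= n <oo) f n < e%:E)%E) ->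
    (\sum_(N <= n <oo) (L%:E * f n) < (eps / 4)%:E)%E.
  move=> Lgt0 f0 chiN tl; rewrite nneseriesZl//.
  have -> : eps / 4 = L * (eps / (4 * L)) by field; rewrite gt_eqF.
  rewrite EFinM lte_pmul2l ?lte_fin//.
  apply: le_lt_trans (nneseries_tail_le f0 chiN) _.
  by apply: tl; rewrite divr_gt0// mulr_gt0.
have plain (f : nat -> \bar R) (chi : R -> nat) :
    (forall n, (0 <= f n)%E) -> (chi (eps / 4) <= N)%N ->
    (forall e, 0 < e -> (\sum_(chi e <= n <oo) f n < e%:E)%E) ->
    (\sum_(N <= n <oo) f n < (eps / 4)%:E)%E.
  move=> f0 chiN tl.
  exact: le_lt_trans (nneseries_tail_le f0 chiN) (tl _ eps4).
have g30 n : (0 <= (E0 + K0)%:E * f3 n)%E by rewrite mule_ge0// lee_fin ltW.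
have g40 n : (0 <= (D0 + K0)%:E * f4 n)%E by rewrite mule_ge0// lee_fin ltW.
rewrite nneseriesD//; last by move=> *; rewrite !adde_ge0.
rewrite nneseriesD//; last by move=> *; rewrite !adde_ge0.
rewrite nneseriesD//.
have -> : eps = eps / 4 + eps / 4 + eps / 4 + eps / 4 by field.
rewrite !EFinD; apply: lteD; last first.
  by apply: scaled r4 => //; rewrite /N /chi_max !leq_max leqnn ?orbT.
apply: lteD; last first.
  by apply: scaled r3 => //; rewrite /N /chi_max !leq_max leqnn ?orbT.
apply: lteD.
  by apply: plain r1 => //; rewrite /N /chi_max !leq_max leqnn ?orbT.
by apply: plain r2 => //; rewrite /N /chi_max !leq_max leqnn ?orbT.
Qed.

(** * The recursion satisfied by the increments *)

(** Both half-steps of the iteration are of the form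
    [(1 - s) *: (p + e) + s *: z]. With [v = p + e] and [v' = p' + e'], the
    identity behind the bound is

      [((1 - s') v' + s' z') - ((1 - s) v + s z)
         = (1 - s) (v' - v) + s (z' - z) + (s - s') (v' - z')].

    It keeps the old weight [s] in the contracting part and evaluates the
    error of the weights at the new point. *)
Lemma norm_perturbed_convex_step (R : realType) (X : normedModType R)
    (s s' : R) (p p' e e' z z' : X) : 0 <= s <= 1 ->
  `|((1 - s') *: (p' + e') + s' *: z') - ((1 - s) *: (p + e) + s *: z)| <=
  (1 - s) * `|p' - p| + s * `|z' - z| + `|e' - e|
  + `|s' - s| * (`|p' - z'| + `|e'|).
Proof.
move=> /andP[s0 s1].
have -> : ((1 - s') *: (p' + e') + s' *: z') - ((1 - s) *: (p + e) + s *: z) =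
    (1 - s) *: (p' - p) + s *: (z' - z) + (1 - s) *: (e' - e)
    + (s - s') *: ((p' - z') + e').
  pose v := p + e; pose v' := p' + e'.
  have -> : p' - z' + e' = v' - z' by rewrite addrAC.
  have -> : (1 - s) *: (p' - p) + s *: (z' - z) + (1 - s) *: (e' - e) =
      (1 - s) *: (v' - v) + s *: (z' - z).
    by rewrite addrAC -scalerDr opprD addrACA.
  rewrite -/v -/v' !scalerBr [X in _ = X + _]addrACA -opprD.
  rewrite [RHS]addrAC [X in _ = X - _]addrACA -scalerDl -scalerBl.
  by rewrite subrKA subKr.
apply: le_trans (ler_normD _ _) _; apply: lerD.
  apply: le_trans (ler_normD _ _) _; apply: lerD.
    apply: le_trans (ler_normD _ _) _.
    by rewrite !normrZ (ger0_norm s0) ger0_norm// subr_ge0.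
  rewrite normrZ ger0_norm ?subr_ge0//.
  by rewrite ler_piMl// gerBl.
by rewrite normrZ distrC ler_wpM2l// ler_normD.
Qed.

(** Two uses of [norm_perturbed_convex_step]: for [y] the anchor [u] does not
    move, which leaves the factor [1 - alpha n]; for [x] both parts of the
    convex combination move by at most [|y_(n+1) - y_n|], since [U] is
    nonexpansive. *)
Lemma halpern_mann_increment d (Omega : measurableType d) (R : realType)
    (X : normedModType R) (T U : X -> X) (x0 u : Omega -> X)
    (xi delta : nat -> Omega -> X) (alpha beta : nat -> R)
    (x y : nat -> Omega -> X) (n : nat) (w : Omega) :
  nonexpansive U -> (forall n, 0 <= alpha n <= 1) ->
  (forall n, 0 <= beta n <= 1) ->
  halpern_mann T U x0 u xi delta alpha beta x y ->
  `|x n.+2 w - x n.+1 w| <=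
    (1 - alpha n) * `|T (x n.+1 w) - T (x n w)|
    + (`|xi n.+1 w - xi n w| + `|delta n.+1 w - delta n w|
       + `|alpha n.+1 - alpha n| * (`|T (x n.+1 w) - u w| + `|xi n.+1 w|)
       + `|beta n.+1 - beta n|
         * (`|U (y n.+1 w) - y n.+1 w| + `|delta n.+1 w|)).
Proof.
move=> neU al01 be01 [_ yE xE].
have := norm_perturbed_convex_step (beta n.+1) (U (y n w))
  (U (y n.+1 w)) (delta n w) (delta n.+1 w) (y n w) (y n.+1 w) (be01 n).
have := norm_perturbed_convex_step (alpha n.+1) (T (x n w))
  (T (x n.+1 w)) (xi n w) (xi n.+1 w) (u w) (u w) (al01 n).
rewrite -!xE -!yE subrr normr0 mulr0 addr0 => stepy stepx.
have /andP[b0 b1] := be01 n.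
have : (1 - beta n) * `|U (y n.+1 w) - U (y n w)|
    <= (1 - beta n) * `|y n.+1 w - y n w|.
  by rewrite ler_wpM2l ?subr_ge0.
by move: stepx stepy; lra.
Qed.

Lemma halpern_mann_measurable d (Omega : measurableType d) (R : realType)
    (X : normedModType R) (T U : X -> X) (x0 u : Omega -> X)
    (xi delta : nat -> Omega -> X) (alpha beta : nat -> R)
    (x y : nat -> Omega -> X) :
  separable X -> nonexpansive T -> nonexpansive U ->
  borel_random_variable x0 -> borel_random_variable u ->
  (forall n, borel_random_variable (xi n)) ->
  (forall n, borel_random_variable (delta n)) ->
  halpern_mann T U x0 u xi delta alpha beta x y ->
  (forall n, borel_random_variable (x n)) /\
  (forall n, borel_random_variable (y n)).
Proof.
move=> sX neT neU mx0 mu mxi mdelta [x0E yE xE].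
have cT := nonexpansive_continuous neT.
have cU := nonexpansive_continuous neU.
have my n : borel_random_variable (x n) -> borel_random_variable (y n).
  move=> mx; rewrite (_ : y n = fun w =>
    (1 - alpha n) *: (T (x n w) + xi n w) + alpha n *: u w); last exact/funext.
  apply: borel_random_variableD => //; apply: borel_random_variableZ => //.
  apply: borel_random_variableD => //.
  exact: borel_random_variable_comp (mx).
have mx n : borel_random_variable (x n).
  elim: n => [|n IH]; first by rewrite (_ : x 0%N = x0)//; exact/funext.
  rewrite (_ : x n.+1 = fun w =>
    (1 - beta n) *: (U (y n w) + delta n w) + beta n *: y n w);
    last exact/funext.
  apply: borel_random_variableD => //; apply: borel_random_variableZ.
    apply: borel_random_variableD => //.
    exact: borel_random_variable_comp (my n IH).
  exact: my.
by split=> // n; exact: my.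
Qed.

Unset Implicit Arguments.

(** * Rates for the stochastic Halpern-Mann iteration *)

Theorem theorem3p2 (R : realType) (d : measure_display)
  (Omega : measurableType d) (P : probability Omega R)
  (X : normedModType R) (sepX : separable X)
  (T U : X -> X) (neT : nonexpansive T) (neU : nonexpansive U)
  (x0 u : Omega -> X) (rv_x0 : borel_random_variable x0) (rv_u : borel_random_variable u)
  (xi delta : nat -> Omega -> X)
  (rv_xi : forall n, borel_random_variable (xi n))
  (rv_delta : forall n, borel_random_variable (delta n))
  (alpha beta : nat -> R)
  (alpha01 : forall n, 0 <= alpha n <= 1)
  (beta01 : forall n, 0 <= beta n <= 1)
  (x y : nat -> Omega -> X)
  (xyE : halpern_mann T U x0 u xi delta alpha beta x y)
  (K0 : nat) (K0_gt0 : (0 < K0)%N)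
  (bound_Tx : forall n,
     ('E_P[fun w => `|T (x n w) - u w|%R] <= (K0%:R)%:E)%E)
  (bound_Uyy : forall n,
     ('E_P[fun w => `|U (y n w) - y n w|%R] <= (K0%:R)%:E)%E)
  (bound_Uu : ('E_P[fun w => `|U (u w) - u w|%R] <= (K0%:R)%:E)%E)
  (bound_Uyu : forall n,
     ('E_P[fun w => `|U (y n w) - u w|%R] <= (K0%:R)%:E)%E)
  (theta : nat -> R -> nat) (div_alpha : rate_sum_divergence alpha theta)
  (chi1 chi2 chi3 chi4 : R -> nat)
  (cvg_xi : rate_sum_convergence
     (fun n => 'E_P[fun w => `|xi n.+1 w - xi n w|%R]%E) chi1)
  (cvg_delta : rate_sum_convergence
     (fun n => 'E_P[fun w => `|delta n.+1 w - delta n w|%R]%E) chi2)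
  (cvg_alpha : rate_sum_convergence
     (fun n => (`|alpha n.+1 - alpha n|)%:E) chi3)
  (cvg_beta : rate_sum_convergence
     (fun n => (`|beta n.+1 - beta n|)%:E) chi4)
  (B1 B2 B3 B4 : R)
  (bound_xi :
     (\sum_(0 <= n <oo) 'E_P[fun w => `|xi n.+1 w - xi n w|%R] <= B1%:E)%E)
  (bound_delta :
     (\sum_(0 <= n <oo) 'E_P[fun w => `|delta n.+1 w - delta n w|%R]
        <= B2%:E)%E)
  (bound_alpha :
     (\sum_(0 <= n <oo) (`|alpha n.+1 - alpha n|%R)%:E <= B3%:E)%E)
  (bound_beta :
     (\sum_(0 <= n <oo) (`|beta n.+1 - beta n|%R)%:E <= B4%:E)%E)
  (E0 D0 : R)
  (bound_E0 : forall n, ('E_P[fun w => `|xi n w|%R] <= E0%:E)%E)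
  (bound_D0 : forall n, ('E_P[fun w => `|delta n w|%R] <= D0%:E)%E) :
  let chi := chi_max chi1 chi2 chi3 chi4 K0%:R E0 D0 in
  let B := B1 + B2 + B3 * (E0 + K0%:R) + B4 * (D0 + K0%:R) in
  let K := 2 * K0%:R + E0 + D0 + B in
  rate_to0 (fun n => 'E_P[fun w => `|x n.+1 w - x n w|%R]%E)
    (phi_rate K theta chi) /\
  rate_as_to0 P (fun n w => `|x n.+1 w - x n w|) (psi_rate K theta chi).
Proof.
move=> chi B K.
have [mx my] := halpern_mann_measurable
  sepX neT neU rv_x0 rv_u rv_xi rv_delta xyE.
have mT (f : Omega -> X) : borel_random_variable f ->
    borel_random_variable (fun w => T (f w)).
  by apply: borel_random_variable_comp; exact: nonexpansive_continuous.
have mU (f : Omega -> X) : borel_random_variable f ->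
    borel_random_variable (fun w => U (f w)).
  by apply: borel_random_variable_comp; exact: nonexpansive_continuous.
have mN (f : Omega -> X) : borel_random_variable f ->
    measurable_fun setT (fun w => `|f w| : R).
  exact: measurable_normr_borel.
have mD (f g : Omega -> X) : borel_random_variable f ->
    borel_random_variable g ->
    measurable_fun setT (fun w => `|f w - g w| : R).
  by move=> mf mg; apply: mN; exact: (borel_random_variableB sepX mf mg).
(* [C] is split into its four parts because each has its own bound in
   expectation. *)
pose A n w := `|x n.+1 w - x n w|.
pose G n w := `|T (x n.+1 w) - T (x n w)|.
pose Cx n w := `|xi n.+1 w - xi n w|.
pose Cd n w := `|delta n.+1 w - delta n w|.
pose Ca n w := `|T (x n.+1 w) - u w| + `|xi n.+1 w|.
pose Cb n w := `|U (y n.+1 w) - y n.+1 w| + `|delta n.+1 w|.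
pose C n w := Cx n w + Cd n w + `|alpha n.+1 - alpha n| * Ca n w
  + `|beta n.+1 - beta n| * Cb n w.
have mA n : measurable_fun setT (A n) by apply: mD.
have mG n : measurable_fun setT (G n) by apply: mD; exact: mT.
have mCx n : measurable_fun setT (Cx n) by apply: mD.
have mCd n : measurable_fun setT (Cd n) by apply: mD.
have mCa n : measurable_fun setT (Ca n).
  by apply: measurable_funD; [apply: mD => //; exact: mT|exact: mN].
have mCb n : measurable_fun setT (Cb n).
  by apply: measurable_funD; [apply: mD => //; exact: mU|exact: mN].
have mZ (a : R) (f : Omega -> R) : measurable_fun setT f ->
  measurable_fun setT (fun w => a * f w) by move=> mf; apply: measurable_funM.
have mC1 n : measurable_fun setT (fun w => Cx n w + Cd n w).
  exact: measurable_funD.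
have mC2 n : measurable_fun setT
    (fun w => Cx n w + Cd n w + `|alpha n.+1 - alpha n| * Ca n w).
  by apply: measurable_funD => //; exact: mZ.
have mC n : measurable_fun setT (C n).
  by apply: measurable_funD => //; exact: mZ.
have A0 n w : 0 <= A n w by exact: normr_ge0.
have G0 n w : 0 <= G n w by exact: normr_ge0.
have Cx0 n w : 0 <= Cx n w by exact: normr_ge0.
have Cd0 n w : 0 <= Cd n w by exact: normr_ge0.
have Ca0 n w : 0 <= Ca n w by exact: addr_ge0.
have Cb0 n w : 0 <= Cb n w by exact: addr_ge0.
have C10 n w : 0 <= Cx n w + Cd n w by exact: addr_ge0.
have C20 n w : 0 <= Cx n w + Cd n w + `|alpha n.+1 - alpha n| * Ca n w.
  by apply: addr_ge0 => //; exact: mulr_ge0.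
have C0 n w : 0 <= C n w by apply: addr_ge0 => //; exact: mulr_ge0.
have E0_ge0 : 0 <= E0.
  rewrite -lee_fin; apply: le_trans (bound_E0 0); exact: expectation_ge0.
have D0_ge0 : 0 <= D0.
  rewrite -lee_fin; apply: le_trans (bound_D0 0); exact: expectation_ge0.
have K0R : 0 < K0%:R :> R by rewrite ltr0n.
have EK0 : 0 < E0 + K0%:R by rewrite ltr_wpDl.
have DK0 : 0 < D0 + K0%:R by rewrite ltr_wpDl.
have EK : 2 * K0%:R <= K.
  have nneg (b : R) (f : nat -> \bar R) : (forall n, (0 <= f n)%E) ->
      (\sum_(0 <= n <oo) f n <= b%:E)%E -> 0 <= b.
    move=> f0 fb; rewrite -lee_fin; apply: le_trans fb.
    by apply: nneseries_ge0.
  have B1_ge0 : 0 <= B1 by apply: nneg bound_xi => n; exact: expectation_ge0.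
  have B2_ge0 : 0 <= B2 by apply: nneg bound_delta => n; exact: expectation_ge0.
  have B3_ge0 : 0 <= B3 by apply: nneg bound_alpha => n; rewrite lee_fin.
  have B4_ge0 : 0 <= B4 by apply: nneg bound_beta => n; rewrite lee_fin.
  have := mulr_ge0 B3_ge0 (ltW EK0); have := mulr_ge0 B4_ge0 (ltW DK0).
  by rewrite /K /B; lra.
have Kgt0 : 0 < K by apply: lt_le_trans EK; rewrite mulr_gt0.
have al1 n : 0 <= 1 - alpha n by rewrite subr_ge0 (andP (alpha01 n)).2.
have EG n : ('E_P[G n] <= K%:E)%E.
  apply: (@le_trans _ _ ('E_P[fun w =>
      (`|T (x n.+1 w) - u w| + `|T (x n w) - u w|)%R])%E).
    apply: ge0_expectation_le => //.
      by apply: measurable_funD; apply: mD => //; exact: mT.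
    move=> w; rewrite /G -(subrKA (u w)) [`|T (x n w) - _|]distrC.
    exact: ler_normD.
  rewrite ge0_expectationD//; [|by apply: mD => //; exact: mT..].
  apply: (@le_trans _ _ (2 * K0%:R)%:E); last by rewrite lee_fin.
  have -> : 2 * K0%:R = K0%:R + K0%:R :> R by ring.
  by rewrite EFinD leeD.
have GA n w : G n w <= A n w by exact: neT.
have step n w : A n.+1 w <= (1 - alpha n) * G n w + C n w.
  exact: (halpern_mann_increment _ _ neU alpha01 beta01 xyE).
have EC n : ('E_P[C n] <= 'E_P[Cx n] + 'E_P[Cd n]
    + (E0 + K0%:R)%:E * `|alpha n.+1 - alpha n|%:E
    + (D0 + K0%:R)%:E * `|beta n.+1 - beta n|%:E)%E.
  have ECE : ('E_P[C n] =
      'E_P[fun w => (Cx n w + Cd n w + `|alpha n.+1 - alpha n| * Ca n w)%R]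
      + `|beta n.+1 - beta n|%:E * 'E_P[Cb n])%E.
    rewrite ge0_expectationD//; [|by move=> w; rewrite mulr_ge0|exact: mZ].
    by rewrite ge0_expectationZl.
  rewrite ECE ge0_expectationD//; [|by move=> w; rewrite mulr_ge0|exact: mZ].
  rewrite ge0_expectationD// ge0_expectationZl//.
  rewrite ![((_ + _)%:E * _)%E]muleC.
  apply: leeD; [apply: leeD => //|]; rewrite lee_wpmul2l ?lee_fin//.
    rewrite ge0_expectationD//; [|by apply: mD => //; exact: mT|exact: mN].
    by rewrite addrC EFinD leeD.
  rewrite ge0_expectationD//; [|by apply: mD => //; exact: mU|exact: mN].
  by rewrite addrC EFinD leeD.
have tail eps : 0 < eps -> (\sum_(chi eps <= n <oo) 'E_P[C n] < eps%:E)%E.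
  move=> eps0; apply: le_lt_trans (chi_max_tail _ _ _ _
    cvg_xi cvg_delta cvg_alpha cvg_beta EK0 DK0 eps0).
  - apply: lee_nneseries => n *; [exact: expectation_ge0|exact: EC].
  - by move=> n; exact: expectation_ge0.
  - by move=> n; exact: expectation_ge0.
  - by move=> n; rewrite lee_fin.
  - by move=> n; rewrite lee_fin.
have rateE : rate_to0 (fun n => 'E_P[A n]%E) (phi_rate K theta chi).
  apply: (@rate_of_contraction _ _ (fun n => 'E_P[G n]%E)
    (fun n => 'E_P[C n]%E) alpha) => //.
  - by move=> n; exact: expectation_ge0.
  - by move=> n; exact: expectation_ge0.
  - by move=> n; exact: ge0_expectation_le.
  - move=> n; rewrite -ge0_expectationZl// -ge0_expectationD//.
    + apply: ge0_expectation_le => //.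
      by apply: measurable_funD => //; exact: mZ.
    + by move=> w; rewrite mulr_ge0.
    + exact: mZ.
split=> //.
apply: (@rate_as_of_almost_decreasing _ _ _ P A C _) => //.
- move=> n w; apply: le_trans (step n w) _; rewrite lerD2r.
  apply: le_trans (GA n w); rewrite ler_piMl// gerBl.
  by have /andP[] := alpha01 n.
- move=> eps eps0; have eps2 : 0 < eps / 2 by rewrite divr_gt0.
  have le_phi : (chi (eps / 2) <= phi_rate K theta chi eps)%N.
    by rewrite /phi_rate leqW// (rate_sum_divergence_ge _ _ div_alpha).
  apply: (le_lt_trans (nneseries_tail_le _ le_phi)).
    by move=> n; exact: expectation_ge0.
  by apply: lt_le_trans (tail _ eps2) _; rewrite lee_fin; lra.
Qed.
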